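(* Let $A$ be a finite-dimensional Leibniz algebra over a field $F$ and let $M$ be a finite-dimensional $A$-module. There is a basis of $M$ with respect to which the matrices representing all the linear transformations $T_x$ and $S_x$ ($x \in A$) of $M$ are upper triangular if and only if both of the following hold: (i) for every $x \in A$ the minimum polynomials of $T_x$ and $S_x$ on $M$ are products of linear factors over $F$; and (ii) $A^2$ is nil on $M$.
   Context: A Leibniz algebra over a field $F$ is an $F$-vector space $A$ with a bilinear product satisfying the (left) Leibniz identity $x(yz) = (xy)z + y(xz)$ for all $x,y,z \in A$. An $A$-module $M$ is an $F$-vector space with bilinear left and right actions $A \times M \to M$, $(x,m)\mapsto xm$, and $M \times A \to M$, $(m,x)\mapsto mx$, such that for all $x,y\in A$, $m \in M$: $x(ym) = (xy)m + y(xm)$, $x(my) = (xm)y + m(xy)$, and $m(xy) = (mx)y + x(my)$. For $x \in A$, $T_x: M \to M$ denotes left multiplication $m \mapsto xm$ and $S_x : M \to M$ denotes right multiplication $m \mapsto mx$. $A^2$ denotes the span of all products $xy$ with $x,y\in A$. A subalgebra $C$ of $A$ is said to be nil on $M$ if $T_x$ is a nilpotent linear transformation of $M$ for every $x \in C$ (it is known that then $S_x$ is nilpotent as well for every $x\in C$, and that $C$ acts nilpotently on $M$, i.e. there is $n$ such that every product of $n$ operators from $\{T_x, S_x : x \in C\}$ is zero on $M$). *)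

(* Defs.v *)
From HB Require Import structures.
From mathcomp Require Import all_boot all_order all_algebra.

Set Implicit Arguments.
Unset Strict Implicit.
Unset Printing Implicit Defensive.

Import GRing.Theory.
Local Open Scope ring_scope.

Section Leibniz.
Variables (F : fieldType) (A M : vectType F).

Definition leibniz_identity (mul : {bilinear A -> A -> A}) : Prop :=
  forall x y z : A, mul x (mul y z) = mul (mul x y) z + mul y (mul x z).

(* lact x m stands for xm, and ract m x for mx. *)
Definition leibniz_module (mul : {bilinear A -> A -> A})
    (lact : {bilinear A -> M -> M}) (ract : {bilinear M -> A -> M}) : Prop :=
  [/\ forall (x y : A) (m : M),
        lact x (lact y m) = lact (mul x y) m + lact y (lact x m),
      forall (x y : A) (m : M),
        lact x (ract m y) = ract (lact x m) y + ract m (mul x y)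
    & forall (x y : A) (m : M),
        ract m (mul x y) = ract (ract m x) y + lact x (ract m y)].

Definition leftT (lact : {bilinear A -> M -> M}) (x : A) : 'End(M) :=
  linfun (fun m => lact x m).

Definition rightS (ract : {bilinear M -> A -> M}) (x : A) : 'End(M) :=
  linfun (fun m => ract m x).

Lemma leftTE lact x m : leftT lact x m = lact x m.
Proof. by rewrite lfunE. Qed.

Lemma rightSE ract x m : rightS ract x m = ract m x.
Proof. by rewrite (lfunE (applyr ract x)). Qed.

Definition in_square (mul : {bilinear A -> A -> A}) (x : A) : Prop :=
  exists s : seq (A * A), x \in <<[seq mul p.1 p.2 | p <- s]>>%VS.

Definition nilpotent_lfun (f : 'End(M)) : Prop :=
  exists n : nat, forall m : M, iter n f m = 0.

Definition nil_on (C : A -> Prop) (lact : {bilinear A -> M -> M}) : Prop :=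
  forall x : A, C x -> nilpotent_lfun (leftT lact x).

End Leibniz.

Section LinearMaps.
Variables (F : fieldType) (V : vectType F).

Definition matrix_in (e : (\dim {:V}).-tuple V) (f : 'End(V)) :
    'M[F]_(\dim {:V}) := \matrix_(i, j) coord e i (f e`_j).

Definition upper_triangular n (B : 'M[F]_n) : Prop :=
  forall i j : 'I_n, (j < i)%N -> B i j = 0.

Definition powf (f : 'End(V)) (n : nat) : 'End(V) :=
  iter n (fun g => (f \o g)%VF) \1%VF.

Definition horner_lfun (f : 'End(V)) (p : {poly F}) : 'End(V) :=
  \sum_(i < size p) p`_i *: powf f i.

(* The library's mxminpoly only covers matrices of size n.+1; here V may be 0,
   in which case the minimum polynomial is 1. *)
Definition minimum_poly (f : 'End(V)) (p : {poly F}) : Prop :=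
  [/\ p \is monic, horner_lfun f p = 0
    & forall q, q != 0 -> horner_lfun f q = 0 -> (size p <= size q)%N].

Definition product_of_linear_factors (p : {poly F}) : Prop :=
  exists rs : seq F, p = \prod_(r <- rs) ('X - r%:P).

(* By [minimum_poly_exists] and [minimum_poly_unique] below, this says that
   the minimum polynomial of f is a product of linear factors. *)
Definition minimum_poly_splits (f : 'End(V)) : Prop :=
  exists2 p, minimum_poly f p & product_of_linear_factors p.

Lemma horner_lfun_widen f (p : {poly F}) n : (size p <= n)%N ->
  horner_lfun f p = \sum_(i < n) p`_i *: powf f i.
Proof.
move=> le_pn; rewrite /horner_lfun (big_ord_widen n (fun i => p`_i *: powf f i)) //.
rewrite big_mkcond /=; apply: eq_bigr => i _.
by case: ltnP => // le_pi; rewrite nth_default // scale0r.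
Qed.

Lemma horner_lfunB f p q :
  horner_lfun f (p - q) = horner_lfun f p - horner_lfun f q.
Proof.
set n := maxn (size p) (size q).
rewrite !(@horner_lfun_widen f _ n) ?leq_maxl ?leq_maxr //; last first.
  by rewrite (leq_trans (size_polyD _ _)) // size_polyN.
by rewrite -sumrB; apply: eq_bigr => i _; rewrite coefB scalerBl.
Qed.

Lemma horner_lfunZ f a p : horner_lfun f (a *: p) = a *: horner_lfun f p.
Proof.
rewrite (@horner_lfun_widen f _ (size p)) ?size_scale_leq // scaler_sumr.
by apply: eq_bigr => i _; rewrite coefZ scalerA.
Qed.

Lemma minimum_poly_unique f p q :
  minimum_poly f p -> minimum_poly f q -> p = q.
Proof.
move=> [mon_p p0 min_p] [mon_q q0 min_q]; apply/eqP; rewrite -subr_eq0.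
apply/negPn/negP => nz.
have eq_sz : size p = size q.
  by apply/eqP; rewrite eqn_leq min_p ?min_q ?monic_neq0.
have := min_p _ nz; rewrite horner_lfunB p0 q0 subrr => /(_ erefl).
apply/negP; rewrite -ltnNge.
have p_gt0 : (0 < size p)%N by rewrite size_poly_gt0 monic_neq0.
rewrite -(prednK p_gt0) ltnS; apply/leq_sizeP => j.
rewrite leq_eqVlt => /orP[/eqP <-|lt_j]; rewrite coefB.
  have := monicP mon_q; have := monicP mon_p; rewrite !lead_coefE -eq_sz.
  by move=> -> ->; rewrite subrr.
by rewrite !nth_default ?subrr // -?eq_sz -(prednK p_gt0).
Qed.

Lemma horner_lfun_sum f (I : Type) (r : seq I) (P : I -> {poly F}) :
  horner_lfun f (\sum_(i <- r) P i) = \sum_(i <- r) horner_lfun f (P i).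
Proof.
have h0 : horner_lfun f 0 = 0 by rewrite /horner_lfun size_poly0 big_ord0.
have hD p q : horner_lfun f (p + q) = horner_lfun f p + horner_lfun f q.
  have := horner_lfunB f (p + q) q; rewrite addrK => ->.
  by rewrite subrK.
exact: (big_morph _ hD h0).
Qed.

Lemma horner_lfunXn f n : horner_lfun f 'X^n = powf f n.
Proof.
rewrite /horner_lfun size_polyXn big_ord_recr /= coefXn eqxx scale1r big1 ?add0r //.
by move=> i _; rewrite coefXn ltn_eqF // scale0r.
Qed.

Lemma annihilating_poly_exists f : exists2 p, p != 0 & horner_lfun f p = 0.
Proof.
set n := (\dim {:'End(V)}).+1.
pose X : n.-tuple 'End(V) := [tuple powf f i | i < n].
have XE j : (j < n)%N -> X`_j = powf f j.
  by move=> lt_jn; rewrite -(tnth_nth _ X (Ordinal lt_jn)) tnth_mktuple.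
have : ~~ free X.
  by rewrite /free size_tuple neq_ltn ltnS dimvS ?subvf.
rewrite freeNE => /existsP[i]; set Y := [tuple of drop i.+1 X] => defX.
have {}defX := @coord_span _ _ _ Y _ defX.
pose p : {poly F} := 'X^i - \sum_j coord Y j X`_i *: 'X^(i.+1 + j).
exists p.
  apply/eqP => /(congr1 (fun q : {poly F} => q`_i)); rewrite coef0 coefB coefXn eqxx.
  rewrite coef_sum big1 => [|j _]; first by rewrite subr0 => /eqP; rewrite oner_eq0.
  by rewrite coefZ coefXn ltn_eqF ?mulr0 // leq_addr.
rewrite horner_lfunB horner_lfunXn horner_lfun_sum -XE // {1}defX.
apply/eqP; rewrite subr_eq0; apply/eqP; apply: eq_bigr => j _.
rewrite horner_lfunZ horner_lfunXn; congr (_ *: _).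
rewrite [RHS]/= -[RHS]/(powf f (i.+1 + j)) -XE ?nth_drop //.
by have := ltn_ord j; rewrite ltn_subRL.
Qed.

Lemma powf_in_spanP f d :
  reflect (exists q, [/\ q \is monic, size q = d.+1 & horner_lfun f q = 0])
          (powf f d \in <<mkseq (powf f) d>>%VS).
Proof.
have sz : size (mkseq (powf f) d) == d by rewrite size_mkseq.
pose Y : d.-tuple 'End(V) := Tuple sz.
have YE (j : 'I_d) : Y`_j = powf f j by rewrite nth_mkseq.
apply: (iffP idP) => [inY|[q [mon_q szq q0]]].
  have defd := @coord_span _ _ _ Y _ inY.
  pose r := \poly_(j < d) (if insub j is Some k then coord Y k (powf f d) else 0).
  have lt_r : (size r < size ('X^d : {poly F}))%N.
    by rewrite size_polyXn ltnS size_poly.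
  have szq : size ('X^d - r) = d.+1.
    by rewrite size_polyDl ?size_polyN // size_polyXn.
  exists ('X^d - r); split=> //.
    by rewrite monicE lead_coefDl ?size_polyN // lead_coefXn.
  rewrite horner_lfunB horner_lfunXn (@horner_lfun_widen f r d) ?size_poly //.
  rewrite {1}defd; apply/eqP; rewrite subr_eq0; apply/eqP; apply: eq_bigr => j _.
  by rewrite YE coef_poly ltn_ord valK.
move: q0; rewrite /horner_lfun szq big_ord_recr /=.
have -> : q`_d = 1 by have := monicP mon_q; rewrite lead_coefE szq.
rewrite scale1r => /eqP; rewrite addrC addr_eq0 => /eqP ->.
rewrite rpredN rpred_sum // => j _; apply/rpredZ/memv_span.
by apply/mapP; exists (j : nat); rewrite ?mem_iota ?add0n ?ltn_ord.
Qed.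

Lemma minimum_poly_exists f : exists p, minimum_poly f p.
Proof.
have annih q : q != 0 -> horner_lfun f q = 0 ->
    powf f (size q).-1 \in <<mkseq (powf f) (size q).-1>>%VS.
  move=> nzq q0; apply/powf_in_spanP; exists ((lead_coef q)^-1 *: q).
  have nzl : (lead_coef q)^-1 != 0 by rewrite invr_eq0 lead_coef_eq0.
  split; last by rewrite horner_lfunZ q0 scaler0.
    by rewrite monicE lead_coefZ mulVf ?lead_coef_eq0.
  by rewrite size_scale // prednK // size_poly_gt0.
have [p0 nz_p0 p0_0] := annihilating_poly_exists f.
have exd : exists d, powf f d \in <<mkseq (powf f) d>>%VS.
  by exists (size p0).-1; apply: annih.
case: (ex_minnP exd) => d /powf_in_spanP[p [mon_p szp p_0]] min_d.
exists p; split=> // q nzq q_0; rewrite szp.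
by rewrite -(prednK (_ : 0 < size q)%N) ?size_poly_gt0 // ltnS min_d // annih.
Qed.

End LinearMaps.

(* Main.v *)
Require Import Defs.
From HB Require Import structures.
From mathcomp Require Import all_boot all_order all_algebra.
Set Implicit Arguments.
Unset Strict Implicit.
Unset Printing Implicit Defensive.
Import GRing.Theory.
Local Open Scope ring_scope.

(** The two sides are related through flags of M.

    If a basis triangularizes all the T_x and S_x, its initial segments span a
    flag D on which each of them acts, modulo the previous step, as a scalar.
    The product of the X - c over these scalars annihilates the operator, so
    its minimum polynomial is a product of linear factors
    ([triangular_splits]).  Moreover T_(xy) = [T_x, T_y], and a commutator of
    two such operators pushes the flag down by one step, hence so does T_z for
    every z in A^2, which is therefore nilpotent.

    Conversely, a triangularizing basis is obtained by extending a basis of a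
    submodule U of M, as long as U is proper, by a vector that all operators
    send to a multiple of itself modulo U ([triangular_basis],
    [stable_extension]).  To avoid quotients, everything is stated relatively
    to U.

    - The left multiplications form a Lie algebra L of endomorphisms that
      split, and [L, L] lies in the Lie algebra N of the T_z with z in A^2,
      whose elements are nilpotent.  By Engel's theorem ([engel]) N kills,
      modulo U, some vectors of any L-stable X not contained in U; these
      vectors form an L-stable subspace on which L acts commutatively modulo
      U, and commuting endomorphisms that split have a common eigenvector
      ([common_eigenvector_modulo]).
    - The right multiplications follow from the identity S_y (S_x + T_x) = 0
      ([rightS_killer]).  Let Z be the subspace of the vectors that all S_y
      send into U; it is stable under the T_x.  If Z is not contained in U, an
      eigenvector of the T_x is taken in Z, where every S_y vanishes modulo U.
      Otherwise S_x = - T_x modulo U, and any common eigenvector of the T_x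
      will do.

    Engel's theorem itself is proved by growing a subalgebra H of N that acts
    nilpotently: some x in N outside H normalizes H
    ([acts_nilpotently_normalizer]), and then H + <x> still acts nilpotently
    ([acts_nilpotently_add_line]). *)

(** * Engel's theorem for Lie algebras of endomorphisms *)

Lemma ltn_dim_add_line (F : fieldType) (V : vectType F) (U : {vspace V}) v :
  v \notin U -> (\dim U < \dim (U + <[v]>))%N.
Proof.
move=> vU; rewrite ltn_neqAle dimvS ?addvSl // andbT.
rewrite (eq_leqif (dimv_leqif_eq (addvSl _ _))).
by apply: contra vU => /eqP->; apply: (subvP (addvSr _ _) _ (memv_line _)).
Qed.

Section Engel.
Variables (F : fieldType) (V : vectType F).
Implicit Types (f g h x : 'End(V)) (H N : {vspace 'End(V)}) (U X : {vspace V}).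

Lemma span_apply (s : seq 'End(V)) f (v : V) (W : {vspace V}) :
  (forall g, g \in s -> g v \in W) -> f \in <<s>>%VS -> f v \in W.
Proof.
move=> sW /(@coord_span _ _ _ (in_tuple s)) ->.
rewrite sum_lfunE; apply: memv_suml => i _.
by rewrite scale_lfunE rpredZ // sW // mem_nth.
Qed.

Definition bracket f g : 'End(V) := ((f \o g) - (g \o f))%VF.

Lemma bracketE f g v : bracket f g v = f (g v) - g (f v).
Proof. by rewrite !(comp_lfunE, lfun_simp). Qed.

Lemma bracketC f g : bracket f g = - bracket g f.
Proof. by rewrite /bracket opprB. Qed.

Lemma bracketxx f : bracket f f = 0.
Proof. exact: subrr. Qed.

Lemma bracketDl f g h : bracket (f + g) h = bracket f h + bracket g h.
Proof. by rewrite /bracket comp_lfunDl comp_lfunDr opprD addrACA. Qed.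

Lemma bracketZl c f h : bracket (c *: f) h = c *: bracket f h.
Proof. by rewrite /bracket -comp_lfunZl -comp_lfunZr scalerBr. Qed.

Definition stable (H : {vspace 'End(V)}) (X : {vspace V}) :=
  forall f v, f \in H -> v \in X -> f v \in X.

Definition bracket_closed (H : {vspace 'End(V)}) :=
  forall f g, f \in H -> g \in H -> bracket f g \in H.

Definition transporter (H : {vspace 'End(V)}) (U : {vspace V}) : {vspace V} :=
  (\bigcap_(i < \dim H) (vbasis H)`_i @^-1: U)%VS.

Lemma transporterP H U v :
  reflect (forall f, f \in H -> f v \in U) (v \in transporter H U).
Proof.
rewrite memvE; apply: (iffP subv_bigcapP) => [vH f|vH i _].
  rewrite -{1}(span_basis (vbasisP H)); apply: span_apply => g /(nthP 0).
  case=> i; rewrite size_tuple => lt_i <-.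
  by rewrite memv_preim memvE; apply: (vH (Ordinal lt_i)).
by rewrite -memvE -memv_preim vH // vbasis_mem // mem_nth // size_tuple.
Qed.

(** The quotient-free form of the conclusion of Engel's theorem: H kills a
    nonzero vector in each nonzero module of the form (X + U) / U.  Asking it
    for all pairs makes the property inductive, and equivalent to the vanishing
    of all long enough products of elements of H. *)
Definition acts_nilpotently (H : {vspace 'End(V)}) :=
  forall U X : {vspace V}, stable H U -> stable H X -> ~~ (X <= U)%VS ->
    exists v, [/\ v \in X, v \notin U & forall h, h \in H -> h v \in U].

Definition word (s : seq 'End(V)) (v : V) : V :=
  foldr (fun h u => fun_of_lfun h u) v s.

Lemma wordB s u v : word s (u - v) = word s u - word s v.
Proof. by elim: s => //= h s ->; rewrite linearB. Qed.

Lemma word0 s : word s 0 = 0.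
Proof. by elim: s => //= h s ->; rewrite linear0. Qed.

(** By induction on the codimension of a stable U, all long enough words map V
    into U: they map it into U + <v0>, where H sends v0 into U, and one more
    letter then leads into U. *)
Lemma acts_nilpotently_words H : acts_nilpotently H ->
  exists n, forall s v, {subset s <= H} -> (n <= size s)%N -> word s v = 0.
Proof.
move=> nilH.
suff words_into k : forall U, stable H U -> (\dim {:V} - \dim U <= k)%N ->
    exists n, forall s v, {subset s <= H} -> (n <= size s)%N -> word s v \in U.
  have [|n Hn] := words_into _ 0%VS _ (leqnn _).
    by move=> f v _; rewrite !memv0 => /eqP->; rewrite linear0.
  by exists n => s v sH le_n; apply/eqP; rewrite -memv0 Hn.
elim: k => [|k IHk] U stabU le_k; have [sVU|nsVU] := boolP ({:V} <= U)%VS.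
- by exists 0 => s v _ _; apply: (subvP sVU); apply: memvf.
- case/negP: nsVU; rewrite -(geq_leqif (dimv_leqif_sup (subvf U))).
  by rewrite -subn_eq0 -leqn0.
- by exists 0 => s v _ _; apply: (subvP sVU); apply: memvf.
have [v0 [_ v0U Hv0]] : exists v, [/\ v \in {:V}%VS, v \notin U
                      & forall h, h \in H -> h v \in U].
  by apply: nilH => // f v _ _; apply: memvf.
have stabU' f v : f \in H -> v \in (U + <[v0]>)%VS -> f v \in U.
  move=> fH /memv_addP[u uU [_ /vlineP[c ->] ->]].
  by rewrite linearD linearZ /= rpredD ?rpredZ ?Hv0 ?stabU.
have [||n Hn] := IHk (U + <[v0]>)%VS.
- by move=> f v fH vU; apply: (subvP (addvSl _ _)); apply: stabU'.
- move: le_k; rewrite !leq_subLR => le_k; apply: leq_trans le_k _.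
  by rewrite addnS -addSn leq_add2r ltn_dim_add_line.
exists n.+1 => -[//|h s] v sH le_n /=.
apply: stabU'; first by apply: sH; rewrite mem_head.
by apply: Hn => // g gs; apply: sH; rewrite inE gs orbT.
Qed.

(** If n letters of H always compose to 0, then 2n successive brackets with
    elements of H annihilate every x, since each term of the expansion has
    at least n letters on one side of x.  So the process of replacing x, as
    long as it does not normalize H, by some [h, x] outside H, must stop. *)
Lemma acts_nilpotently_normalizer H N : acts_nilpotently H ->
    (H <= N)%VS -> ~~ (N <= H)%VS -> bracket_closed N ->
  exists x, [/\ x \in N, x \notin H & forall h, h \in H -> bracket h x \in H].
Proof.
move=> nilH sHN nsNH closN; have [n Hn] := acts_nilpotently_words nilH.
(* x is the result of m brackets: a x b vanishes for all words a and b over H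
   that have together at least 2n - m letters. *)
suff descend k : forall m x, (n + n <= m + k)%N -> x \in N -> x \notin H ->
    (forall a b v, {subset a <= H} -> {subset b <= H} ->
       (n + n <= size a + size b + m)%N -> word a (x (word b v)) = 0) ->
    exists y, [/\ y \in N, y \notin H & forall h, h \in H -> bracket h y \in H].
  have /subvPn[x xN xH] := nsNH.
  apply: (descend (n + n)%N 0 x) => // a b v aH bH; rewrite addn0 => le_n.
  have [le_na|lt_an] := leqP n (size a); first by rewrite Hn.
  rewrite (Hn b) ?linear0 ?word0 // -(leq_add2l n) (leq_trans le_n) //.
  by rewrite leq_add2r ltnW.
elim: k => [|k IHk] m x le_n xN xH x0.
  suff E : x = 0 by rewrite E mem0v in xH.
  apply/lfunP => v; rewrite zero_lfunE.
  by apply: (x0 [::] [::]) => //; rewrite addn0 in le_n.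
have [/allP allH|/allPn[h hH nH]] :=
    boolP (all (fun h => bracket h x \in H) (vbasis H)).
  exists x; split=> // h.
  rewrite -{1}(span_basis (vbasisP H)) => /coord_span ->.
  apply: (big_ind (fun g => bracket g x \in H)) => [|f g fH gH|i _].
  - by rewrite -(scale0r x) bracketZl scale0r mem0v.
  - by rewrite bracketDl rpredD.
  - by rewrite bracketZl rpredZ // allH // mem_nth // size_tuple.
have {hH} hH := vbasis_mem hH.
apply: (IHk m.+1 (bracket h x)) => //; first by rewrite addSnnS.
  by apply: closN => //; apply: (subvP sHN).
move=> a b v aH bH le_n'; rewrite bracketE wordB.
have := x0 (rcons a h) b v; rewrite /word foldr_rcons => ->; first last.
- by rewrite size_rcons; move: le_n'; rewrite !addSn addnS.
- by [].
- by move=> g; rewrite mem_rcons inE => /orP[/eqP->|/aH].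
have := x0 a (h :: b) v; rewrite /word /= => ->; first by rewrite subrr.
- by [].
- by move=> g; rewrite inE => /orP[/eqP->|/bH].
by rewrite /= addnS addSn -addnS.
Qed.

(** The vectors of X that H sends into U are stable under x, because
    h x = [h, x] + x h; x being nilpotent, the last iterate by x of such a
    vector that is outside U is sent into U by x as well. *)
Lemma acts_nilpotently_add_line H x : acts_nilpotently H ->
    (forall h, h \in H -> bracket h x \in H) -> nilpotent_lfun x ->
  acts_nilpotently (H + <[x]>)%VS.
Proof.
move=> nilH normx [k xk0] U X stabU stabX nsXU.
have sH : (H <= H + <[x]>)%VS by apply: addvSl.
have xHx : x \in (H + <[x]>)%VS by apply: (subvP (addvSr _ _) _ (memv_line _)).
have [||//|v0 [v0X v0U Hv0]] := nilH U X.
- by move=> f v /(subvP sH); apply: stabU.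
- by move=> f v /(subvP sH); apply: stabX.
pose bad i := iter i x v0 \in U.
have ex_bad : exists i, bad i by exists k; rewrite /bad xk0 mem0v.
case: (ex_minnP ex_bad) => -[|i]; rewrite /bad ?(negPf v0U) //= => xiU min_i.
have killed j : iter j x v0 \in X /\ forall h, h \in H -> h (iter j x v0) \in U.
  elim: j => [|j [jX jH]] /=; first by [].
  split=> [|h hH]; first exact: stabX.
  have -> : h (x (iter j x v0))
      = bracket h x (iter j x v0) + x (h (iter j x v0)).
    by rewrite bracketE subrK.
  by apply: rpredD; [apply/jH/normx | apply: stabU; last exact: jH].
have [iX iH] := killed i.
exists (iter i x v0); split=> // [|_ /memv_addP[h hH [_ /vlineP[c ->] ->]]].
  by apply/negP => /min_i; rewrite ltnn.
by rewrite !lfun_simp rpredD ?rpredZ ?xiU ?iH.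
Qed.

Theorem engel N : bracket_closed N -> (forall f, f \in N -> nilpotent_lfun f) ->
  acts_nilpotently N.
Proof.
move=> closN nilN.
(* H grows by one line at a time; as its dimension cannot exceed that of N, it
   ends up equal to N. *)
suff grow k : exists H, [/\ (H <= N)%VS, acts_nilpotently H, bracket_closed H
                          & (N <= H)%VS \/ (k <= \dim H)%N].
  have [H [sHN nilH _ [sNH|]]] := grow (\dim N).+1.
    by have -> : N = H by apply/eqP; rewrite eqEsubv sNH.
  by rewrite ltnNge dimvS.
elim: k => [|k [H [sHN nilH closH]]].
  exists 0%VS; split; rewrite ?sub0v //; last by right.
    move=> U X _ _ /subvPn[v vX vU]; exists v; split=> // h.
    by rewrite memv0 => /eqP->; rewrite lfunE /= mem0v.
  move=> f g; rewrite !memv0 => /eqP-> /eqP->.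
  by apply/eqP/lfunP => v; rewrite bracketE !lfunE subrr.
have [sNH _|nsNH [//|le_k]] := boolP (N <= H)%VS.
  by exists H; split=> //; left.
have [x [xN xH normx]] := acts_nilpotently_normalizer nilH sHN nsNH closN.
exists (H + <[x]>)%VS; split.
- by rewrite subv_add sHN -memvE.
- exact: (acts_nilpotently_add_line nilH normx (nilN x xN)).
- move=> f g /memv_addP[h hH [_ /vlineP[c ->] ->]].
  move=> /memv_addP[h' hH' [_ /vlineP[c' ->] ->]].
  apply: (subvP (addvSl _ _)); rewrite bracketDl bracketZl.
  apply: rpredD; [|apply: rpredZ]; rewrite bracketC bracketDl bracketZl rpredN.
    by rewrite rpredD ?closH // bracketC scalerN rpredN rpredZ ?normx.
  by rewrite bracketxx scaler0 addr0 normx.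
by right; apply: leq_ltn_trans le_k (ltn_dim_add_line xH).
Qed.
End Engel.

(** * Endomorphisms whose minimum polynomial splits *)

Section SplitEndomorphisms.
Variables (F : fieldType) (V : vectType F).
Implicit Types (f : 'End(V)) (p q : {poly F}) (U X : {vspace V}).

Lemma powfD f m n : powf f (m + n) = (powf f m \o powf f n)%VF.
Proof.
elim: m => [|m IHm]; first by rewrite comp_lfun1l.
by rewrite addSn /= IHm comp_lfunA.
Qed.

Lemma horner_lfunM f p q :
  horner_lfun f (p * q) = (horner_lfun f p \o horner_lfun f q)%VF.
Proof.
have expand (r : {poly F}) : r = \sum_(i < size r) r`_i *: 'X^i.
  by rewrite -poly_def coefK.
apply/lfunP => v; rewrite {1}(expand p) {1}(expand q) mulr_suml horner_lfun_sum.
rewrite comp_lfunE {2}/horner_lfun !sum_lfunE; apply: eq_bigr => i _.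
rewrite mulr_sumr horner_lfun_sum !sum_lfunE linear_sum; apply: eq_bigr => j _.
rewrite -scalerAl -scalerAr -exprD !horner_lfunZ horner_lfunXn powfD.
by rewrite !scale_lfunE comp_lfunE [RHS]scale_lfunE [in RHS]linearZ.
Qed.

Lemma horner_lfunXsubC f c : horner_lfun f ('X - c%:P) = f - c *: \1%VF.
Proof.
rewrite horner_lfunB -['X]expr1 horner_lfunXn /= comp_lfun1r.
by rewrite -[c%:P]mulr1 mul_polyC horner_lfunZ -(expr0 'X) horner_lfunXn.
Qed.

Lemma horner_lfun_XsubC_mul f c p v :
  horner_lfun f (('X - c%:P) * p) v
    = f (horner_lfun f p v) - c *: horner_lfun f p v.
Proof.
rewrite horner_lfunM horner_lfunXsubC comp_lfunE.
by rewrite !(add_lfunE, opp_lfunE, scale_lfunE, id_lfunE).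
Qed.

Lemma horner_lfun1 f v : horner_lfun f 1 v = v.
Proof. by rewrite -(expr0 'X) horner_lfunXn id_lfunE. Qed.

(** In a product of factors f - r that annihilates a vector outside U, some
    factor is the first one to send the image of this vector into U. *)
Lemma eigenvector_modulo f U X : minimum_poly_splits f ->
    (forall v, v \in X -> f v \in X) -> ~~ (X <= U)%VS ->
  exists c v, [/\ v \in X, v \notin U & f v - c *: v \in U].
Proof.
case=> p [_ p0 _] [rs def_p] fX /subvPn[v0 v0X v0U].
pose q := fun s : seq F => \prod_(r <- s) ('X - r%:P).
have : horner_lfun f (q rs) v0 \in U by rewrite /q -def_p p0 zero_lfunE mem0v.
have qX s : horner_lfun f (q s) v0 \in X.
  elim: s => [|r s IHs]; first by rewrite /q big_nil horner_lfun1.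
  by rewrite /q big_cons horner_lfun_XsubC_mul rpredB ?rpredZ ?fX.
elim: rs {def_p} => [|r rs IHrs].
  by rewrite /q big_nil horner_lfun1 (negPf v0U).
have [/IHrs //|nU] := boolP (horner_lfun f (q rs) v0 \in U).
rewrite {1}/q big_cons horner_lfun_XsubC_mul => qU.
by exists r, (horner_lfun f (q rs) v0).
Qed.

Lemma annihilated_splits f rs :
  horner_lfun f (\prod_(r <- rs) ('X - r%:P)) = 0 -> minimum_poly_splits f.
Proof.
set q := \prod_(r <- rs) _ => q0.
have [p [mon_p p0 min_p]] := minimum_poly_exists f.
have : p %| q.
  have r0 : horner_lfun f (q %% p) = 0.
    have -> : q %% p = q - q %/ p * p by rewrite {2}(divp_eq q p) addrC addKr.
    by rewrite horner_lfunB q0 horner_lfunM p0 comp_lfun0r subr0.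
  apply/negPn/negP => /min_p/(_ r0).
  by rewrite leqNgt ltn_modp monic_neq0.
move=> /dvdp_prod_XsubC[m].
rewrite eqp_monic ?monic_prod_XsubC // => /eqP def_p.
by exists p; last exists (mask m rs).
Qed.

End SplitEndomorphisms.

(** * Common eigenvectors modulo a stable subspace *)

Section CommonEigenvector.
Variables (F : fieldType) (V : vectType F).
Implicit Types (L N : {vspace 'End(V)}) (U X : {vspace V}).

(** This is Lie's theorem with the nilpotency of [L, L] as a hypothesis, which
    makes it valid in all characteristics. *)
Lemma common_eigenvector_modulo L N U X :
    (N <= L)%VS -> (forall f g, f \in L -> g \in L -> bracket f g \in N) ->
    (forall f, f \in N -> nilpotent_lfun f) ->
    (forall f, f \in L -> minimum_poly_splits f) ->
    stable L U -> stable L X -> ~~ (X <= U)%VS ->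
  exists v, [/\ v \in X, v \notin U
              & forall f, f \in L -> f v \in (U + <[v]>)%VS].
Proof.
move=> sNL brN nilN splitL stabU stabX nsXU.
have closN : bracket_closed N.
  by move=> f g /(subvP sNL)fL /(subvP sNL); apply: brN.
have [||//|v0 [v0X v0U Nv0]] := engel closN nilN (U := U) (X := X).
- by move=> f v /(subvP sNL); apply: stabU.
- by move=> f v /(subvP sNL); apply: stabX.
(* Adding the elements f of a basis of L one by one, Y shrinks to a subspace
   where f is a scalar modulo U; it remains L-stable because L acts
   commutatively, modulo U, on the vectors that N sends into U. *)
suff weight_space (s : seq 'End(V)) : {subset s <= L} ->
    exists Y : {vspace V}, [/\ stable L Y, (Y <= X :&: transporter N U)%VS,
      ~~ (Y <= U)%VS
      & forall f, f \in s -> exists c, forall v, v \in Y -> f v - c *: v \in U].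
  have [|Y [_ sY /subvPn[v vY vU] eigY]] := weight_space (vbasis L).
    by move=> f; apply: vbasis_mem.
  exists v; split=> // [|f].
    by have := subvP sY v vY; rewrite memv_cap => /andP[].
  rewrite -{1}(span_basis (vbasisP L)); apply: span_apply => g /eigY[c gY].
  rewrite -(subrK (c *: v) (g v)); apply: memv_add; first exact: gY.
  by rewrite rpredZ ?memv_line.
elim: s => [|f s IHs] sL.
  exists (X :&: transporter N U)%VS; split=> //.
    move=> f v fL; rewrite !memv_cap => /andP[vX /transporterP vN].
    rewrite stabX //; apply/transporterP => n nN.
    rewrite -(subrK (f (n v)) (n (f v))) -bracketE rpredD //.
      by apply/vN/brN => //; apply: (subvP sNL).
    by apply: stabU => //; apply: vN.
  apply/subvPn; exists v0 => //.
  by rewrite memv_cap v0X; apply/transporterP.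
have [|Y [stabY sY nsYU eigY]] := IHs.
  by move=> g gs; apply: sL; rewrite inE gs orbT.
have fL : f \in L by rewrite sL ?mem_head.
have [|c [v [vY vU fvU]]] := eigenvector_modulo (splitL f fL) _ nsYU.
  by move=> v; apply: stabY.
pose fc := f - c *: \1%VF.
have fcE w : fc w = f w - c *: w.
  by rewrite !(add_lfunE, opp_lfunE, scale_lfunE, id_lfunE).
exists (Y :&: fc @^-1: U)%VS; split.
- move=> g w gL; rewrite !memv_cap -!memv_preim !fcE => /andP[wY fwU].
  rewrite stabY //=.
  have -> : f (g w) - c *: g w = bracket f g w + g (f w - c *: w).
    by rewrite bracketE [g (_ - _)]linearB /= [g (_ *: _)]linearZ addrA subrK.
  apply: rpredD; last exact: stabU.
  have := subvP sY w wY; rewrite memv_cap => /andP[_ /transporterP wN].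
  exact/wN/brN.
- by apply: subv_trans sY; apply: capvSl.
- by apply/subvPn; exists v; rewrite // memv_cap vY -memv_preim fcE.
move=> g; rewrite inE => /orP[/eqP->|/eigY[d gY]].
  by exists c => w; rewrite memv_cap -memv_preim fcE => /andP[].
by exists d => w; rewrite memv_cap => /andP[/gY].
Qed.

End CommonEigenvector.

(** * Triangular endomorphisms and flags *)

Section Flags.
Variables (F : fieldType) (V : vectType F).
Implicit Types (f g : 'End(V)) (e : (\dim {:V}).-tuple V).

Lemma memv_take_coord e k v : basis_of {:V} e ->
  (v \in <<take k e>>%VS) <-> (forall i : 'I__, (k <= i)%N -> coord e i v = 0).
Proof.
move=> be; have fe := basis_free be; split=> [|v0].
  move=> /(@coord_span _ _ _ (in_tuple (take k e))) -> i le_ki.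
  rewrite linear_sum big1 // => j _; rewrite linearZ /=.
  have /andP[ltjk ltjn] : (j < k)%N && (j < \dim {:V})%N.
    rewrite -leq_min; apply: leq_trans (ltn_ord j) _.
    by rewrite size_take_min size_tuple.
  rewrite nth_take // (coord_free (Ordinal ltjn) i fe).
  have -> : (Ordinal ltjn == i) = false.
    by apply: ltn_eqF; apply: leq_trans le_ki.
  by rewrite mulr0.
rewrite (coord_basis be (memvf v)); apply: memv_suml => i _.
have [/v0->|lt_ik] := leqP k i; first by rewrite scale0r mem0v.
rewrite rpredZ // memv_span // -(nth_take 0 lt_ik) mem_nth //.
by rewrite size_take_min size_tuple leq_min lt_ik /=.
Qed.

Lemma upper_triangularE e f : basis_of {:V} e ->
  upper_triangular (matrix_in e f)
    <-> (forall j, (j < \dim {:V})%N -> f e`_j \in <<take j.+1 e>>%VS).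
Proof.
move=> be; split=> [tri j lt_j|fe i j lt_ji].
  apply/(memv_take_coord _ _ be) => i lt_ji.
  by have := tri i (Ordinal lt_j) lt_ji; rewrite mxE.
by rewrite mxE; apply: (memv_take_coord _ _ be).1 (fe j (ltn_ord j)) _ _.
Qed.

(** The extension step provides eigenvectors modulo stable subspaces; the span
    of the vectors obtained so far is stable, so it can be repeated. *)
Lemma triangular_basis (P : 'End(V) -> Prop) :
    (forall U : {vspace V}, (forall f v, P f -> v \in U -> f v \in U) ->
       ~~ ({:V} <= U)%VS ->
       exists2 v, v \notin U & forall f, P f -> f v \in (U + <[v]>)%VS) ->
  exists2 e : (\dim {:V}).-tuple V, basis_of {:V} e &
    forall f, P f -> upper_triangular (matrix_in e f).
Proof.
move=> ext.
suff grow k : (k <= \dim {:V})%N -> exists e : seq V, [/\ free e, size e = k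
    & forall f j, P f -> (j < k)%N -> f e`_j \in <<take j.+1 e>>%VS].
  have [e [fe se tri]] := grow _ (leqnn _).
  pose e' : (\dim {:V}).-tuple V := tcast se (in_tuple e).
  have ee' : tval e' = e by rewrite val_tcast.
  have be : basis_of {:V} e' by rewrite basisEfree ee' fe subvf se leqnn.
  exists e' => // f Pf; apply/upper_triangularE => // j lt_j.
  by rewrite ee'; apply: tri.
elim: k => [|k IHk] lt_k; first by exists [::]; split; rewrite ?nil_free.
have [e [fe se tri]] := IHk (ltnW lt_k).
have dim_e : \dim <<e>>%VS = k by apply/eqP; rewrite -se.
have [||v ve Pv] := ext <<e>>%VS.
- move=> f v Pf ve; have : f v \in (f @: <<e>>)%VS by apply: memv_img.
  rewrite limg_span; apply/subvP: (f v); apply/span_subvP => _ /mapP[w we ->].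
  have [j lt_j <-] := nthP 0 we; rewrite se in lt_j.
  by apply: subvP (tri f j Pf lt_j); apply: sub_span => u /mem_take.
- by apply: contraL lt_k => /dimvS; rewrite dim_e -leqNgt.
exists (rcons e v); split; rewrite ?size_rcons ?se //.
  by rewrite (perm_free (permEl (perm_rcons v e))) free_cons ve.
move=> f j Pf; rewrite ltnS leq_eqVlt => /orP[/eqP->|lt_jk].
  rewrite nth_rcons se ltnn eqxx take_oversize ?size_rcons ?se //.
  by rewrite -cats1 span_cat span_seq1 Pv.
by rewrite nth_rcons se lt_jk -cats1 takel_cat ?se // tri.
Qed.

(** For a flag D, the scalar c is the k-th diagonal entry of f. *)
Definition triangular_on (D : nat -> {vspace V}) f :=
  forall k, exists c, forall v, v \in D k.+1 -> f v - c *: v \in D k.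

Definition strictly_triangular_on (D : nat -> {vspace V}) f :=
  forall k v, v \in D k.+1 -> f v \in D k.

Lemma triangular_on_basis e f : basis_of {:V} e ->
  upper_triangular (matrix_in e f) ->
  triangular_on (fun k => <<take k e>>%VS) f.
Proof.
move=> be /(upper_triangularE _ be) tri k.
have [le_nk|lt_kn] := leqP (\dim {:V}) k.
  (* Beyond the end of the basis, take k e is e and any scalar fits. *)
  exists 0 => v _; rewrite take_oversize ?size_tuple //.
  by rewrite (span_basis be) memvf.
have Dk : <<take k.+1 e>>%VS = (<<take k e>> + <[e`_k]>)%VS.
  by rewrite (take_nth 0) ?size_tuple // -cats1 span_cat span_seq1.
have [d dk [_ /vlineP[c ->] fek]] : exists2 d, d \in <<take k e>>%VS &
    exists2 w, w \in <[e`_k]>%VS & f e`_k = d + w.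
  by apply/memv_addP; rewrite -Dk tri.
have fD u : u \in <<take k e>>%VS -> f u \in <<take k e>>%VS.
  move=> /(memv_img f); rewrite limg_span; apply/subvP: (f u).
  apply/span_subvP => _ /mapP[w we ->].
  have [j lt_j <-] := nthP 0 we.
  move: lt_j; rewrite size_take_min size_tuple leq_min => /andP[ltjk ltjn].
  rewrite nth_take //; apply: subvP (tri j ltjn); apply: sub_span => z.
  by rewrite -(@take_takel _ j.+1 k) // => /mem_take.
exists c => v; rewrite Dk => /memv_addP[u uk [_ /vlineP[a ->] ->]].
rewrite linearD linearZ /= fek !scalerDr !scalerA (mulrC a c) opprD addrACA.
by rewrite addrK rpredD ?rpredB ?rpredZ ?fD.
Qed.

(* D is indexed by all natural numbers, so that no bound has to be carried
   around; the spans of the initial segments of a basis form such a sequence,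
   constant from n on. *)
Variables (D : nat -> {vspace V}) (n : nat).
Hypotheses (D0 : D 0 = 0%VS) (Dn : D n = {:V}%VS).
Hypothesis D_mono : forall k, (D k <= D k.+1)%VS.

Lemma strictly_triangular_nilpotent f :
  strictly_triangular_on D f -> nilpotent_lfun f.
Proof.
move=> strict; exists n => v; have : v \in D n by rewrite Dn memvf.
elim: n v => [|k IHk] v; first by rewrite D0 memv0 => /eqP.
by rewrite iterSr => /strict/IHk.
Qed.

Lemma bracket_strictly_triangular f g :
  triangular_on D f -> triangular_on D g ->
  strictly_triangular_on D (bracket f g).
Proof.
move=> tf tg k v vD; have [c fc] := tf k; have [d gd] := tg k.
(* The scalars commute: [f, g] = [f - c, g - d]. *)
have -> : bracket f g v = (f (g v - d *: v) - c *: (g v - d *: v))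
                        - (g (f v - c *: v) - d *: (f v - c *: v)).
  rewrite bracketE [f (_ - _)]linearB [g (_ - _)]linearB /=.
  rewrite [f (_ *: _)]linearZ [g (_ *: _)]linearZ /= !scalerBr !scalerA.
  rewrite (mulrC d c) !opprB !addrA.
  by rewrite [RHS](ACl (1*8*(2*5)*(3*6)*(4*7))) /= !addNr subrr !addr0.
by apply: rpredB; [apply: fc | apply: gd]; apply: (subvP (D_mono k)); auto.
Qed.

Lemma triangular_splits f : triangular_on D f -> minimum_poly_splits f.
Proof.
move=> tf; suff [rs rsD] : exists rs, forall v, v \in D n ->
    horner_lfun f (\prod_(r <- rs) ('X - r%:P)) v = 0.
  apply: (@annihilated_splits _ _ f rs); apply/lfunP => v.
  by rewrite rsD ?Dn ?memvf ?zero_lfunE.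
elim: n => [|k [rs IHk]].
  by exists [::] => v; rewrite D0 memv0 => /eqP->; rewrite linear0.
have [c fc] := tf k; exists (c :: rs) => v /fc/IHk.
rewrite big_cons mulrC horner_lfunM horner_lfunXsubC comp_lfunE.
by rewrite !(add_lfunE, opp_lfunE, scale_lfunE, id_lfunE).
Qed.

End Flags.

(** * Leibniz modules *)

Section Modules.
Variables (F : fieldType) (A M : vectType F).
Variables (mul : {bilinear A -> A -> A}).
Variables (lact : {bilinear A -> M -> M}) (ract : {bilinear M -> A -> M}).

Fact leftT_is_linear : linear (leftT lact).
Proof.
move=> c x y; apply/lfunP => m.
by rewrite add_lfunE scale_lfunE !leftTE linearPl.
Qed.
HB.instance Definition _ :=
  GRing.isLinear.Build F A 'End(M) *:%R (leftT lact) leftT_is_linear.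

Fact rightS_is_linear : linear (rightS ract).
Proof.
move=> c x y; apply/lfunP => m.
by rewrite add_lfunE scale_lfunE !rightSE linearPr.
Qed.
HB.instance Definition _ :=
  GRing.isLinear.Build F A 'End(M) *:%R (rightS ract) rightS_is_linear.

Definition left_ops (B : {vspace A}) : {vspace 'End(M)} :=
  (linfun (leftT lact) @: B)%VS.

Definition right_ops : {vspace 'End(M)} := limg (linfun (rightS ract)).

Lemma left_opsP (B : {vspace A}) f :
  reflect (exists2 x, x \in B & f = leftT lact x) (f \in left_ops B).
Proof.
by apply: (iffP memv_imgP) => -[x xB ->]; exists x; rewrite ?lfunE.
Qed.

Lemma right_opsP f :
  reflect (exists x, f = rightS ract x) (f \in right_ops).
Proof.
apply: (iffP memv_imgP) => [[x _ ->]|[x ->]]; exists x; rewrite ?lfunE //.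
exact: memvf.
Qed.

(** Finitely many products span A^2, which makes A^2 a subspace. *)
Definition vbasis_pairs : seq (A * A) :=
  [seq (x, y) | x <- vbasis {:A}, y <- vbasis {:A}].

Definition square : {vspace A} :=
  <<[seq mul p.1 p.2 | p <- vbasis_pairs]>>%VS.

Lemma in_square_square x : x \in square -> in_square mul x.
Proof. by exists vbasis_pairs. Qed.

Lemma mul_square x y : mul x y \in square.
Proof.
rewrite (coord_vbasis (memvf x)) (coord_vbasis (memvf y)).
rewrite linear_sumlz /=; apply: memv_suml => i _.
rewrite linear_sumr /=; apply: memv_suml => j _.
rewrite linearZl_LR linearZr_LR /= !rpredZ // memv_span //.
apply/mapP; exists ((vbasis {:A})`_i, (vbasis {:A})`_j) => //.
by apply: allpairs_f; rewrite mem_nth // size_tuple.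
Qed.

Hypothesis M_module : leibniz_module mul lact ract.

Lemma leftT_mul x y :
  leftT lact (mul x y) = bracket (leftT lact x) (leftT lact y).
Proof.
case: M_module => lll _ _; apply/lfunP => m.
by rewrite bracketE !leftTE lll addrK.
Qed.

Lemma leftT_rightS x y m :
  leftT lact x (rightS ract y m)
    = rightS ract y (leftT lact x m) + rightS ract (mul x y) m.
Proof. by case: M_module => _ llr _; rewrite !leftTE !rightSE llr. Qed.

(** S_(xy) can be computed in two ways: as [T_x, S_y], and as
    S_y S_x + T_x S_y by the last module axiom. *)
Lemma rightS_killer x y m :
  rightS ract y (rightS ract x m + leftT lact x m) = 0.
Proof.
case: M_module => _ llr lrr; rewrite !rightSE leftTE linearDl.
by have := lrr x y m; rewrite llr addrA -[LHS]add0r => /addIr <-.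
Qed.

(** Wherever all S_y vanish modulo U, an eigenvector of the T_x is enough.  If
    no vector outside U has this property, the vectors (S_x + T_x) v, which
    have it by [rightS_killer], lie in U, and S_x = - T_x modulo U. *)
Lemma stable_extension :
    (forall x, minimum_poly_splits (leftT lact x)) ->
    nil_on (in_square mul) lact ->
  forall U : {vspace M},
    (forall x v, v \in U -> leftT lact x v \in U) ->
    ~~ ({:M} <= U)%VS ->
  exists2 v, v \notin U & forall x, leftT lact x v \in (U + <[v]>)%VS
                                  /\ rightS ract x v \in (U + <[v]>)%VS.
Proof.
move=> splitT nilA U TU nsMU.
have eigenvector (X : {vspace M}) :
    (forall x v, v \in X -> leftT lact x v \in X) -> ~~ (X <= U)%VS ->
  exists v, [/\ v \in X, v \notin U
              & forall x, leftT lact x v \in (U + <[v]>)%VS].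
  move=> TX nsXU.
  have [||||||//|v [vX vU Tv]] := @common_eigenvector_modulo _ _
    (left_ops {:A}) (left_ops square) U X.
  - by apply: limgS; apply: subvf.
  - move=> _ _ /left_opsP[x _ ->] /left_opsP[y _ ->]; apply/left_opsP.
    by exists (mul x y); rewrite ?leftT_mul ?mul_square.
  - by move=> _ /left_opsP[x /in_square_square xA2 ->]; apply: nilA.
  - by move=> _ /left_opsP[x _ ->].
  - by move=> _ v /left_opsP[x _ ->]; apply: TU.
  - by move=> _ v /left_opsP[x _ ->]; apply: TX.
  exists v; split=> // x; apply: Tv; apply/left_opsP.
  by exists x; rewrite ?memvf.
have sUv v : (U <= U + <[v]>)%VS by apply: addvSl.
pose Z := transporter right_ops U.
have ZP v : reflect (forall x, rightS ract x v \in U) (v \in Z).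
  apply: (iffP (transporterP _ _ _)) => [Zv x|Sv _ /right_opsP[x ->]] //.
  by apply: Zv; apply/right_opsP; exists x.
have [sZU|nsZU] := boolP (Z <= U)%VS; last first.
  have [|v [/ZP Sv vU Tv]] := eigenvector Z _ nsZU.
    move=> x v /ZP Sv; apply/ZP => y.
    rewrite -(addrK (rightS ract (mul x y) v) (rightS ract y _)) -leftT_rightS.
    by rewrite rpredB ?TU.
  by exists v => // x; split=> //; apply: (subvP (sUv v)).
have [|v [_ vU Tv]] := eigenvector {:M}%VS _ nsMU.
  by move=> *; apply: memvf.
exists v => // x; split=> //.
rewrite -(addrK (leftT lact x v) (rightS ract x v)) rpredB //.
apply: (subvP (sUv v)); apply: (subvP sZU); apply/ZP => y.
by rewrite rightS_killer mem0v.
Qed.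

End Modules.

Theorem theorem1 (F : fieldType) (A M : vectType F)
    (mul : {bilinear A -> A -> A})
    (lact : {bilinear A -> M -> M}) (ract : {bilinear M -> A -> M})
    (A_leibniz : leibniz_identity mul)
    (M_module : leibniz_module mul lact ract) :
  (exists2 e : (\dim {:M}).-tuple M, basis_of {:M} e &
     forall x : A, upper_triangular (matrix_in e (leftT lact x))
                /\ upper_triangular (matrix_in e (rightS ract x)))
  <->
  (forall x : A, minimum_poly_splits (leftT lact x)
              /\ minimum_poly_splits (rightS ract x))
  /\ nil_on (in_square mul) lact.
Proof.
split=> [[e be tri]|[splitTS nilA]].
  pose D k := <<take k e>>%VS.
  have D0 : D 0 = 0%VS by rewrite /D take0 span_nil.
  have Dn : D (\dim {:M}) = {:M}%VS.
    by rewrite /D take_oversize ?size_tuple // (span_basis be).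
  have D_mono k : (D k <= D k.+1)%VS.
    by apply: sub_span => v; rewrite -(@take_takel _ k k.+1) // => /mem_take.
  have triT x : triangular_on D (leftT lact x).
    by apply: triangular_on_basis => //; case: (tri x).
  split=> [x|x [s xs]].
    split; apply: (triangular_splits D0 Dn) => //.
    by apply: triangular_on_basis => //; case: (tri x).
  apply: (strictly_triangular_nilpotent D0 Dn) => k v vD.
  have : leftT lact x
      \in (linfun (leftT lact) @: <<[seq mul p.1 p.2 | p <- s]>>)%VS.
    by apply/left_opsP; exists x.
  rewrite limg_span; apply: span_apply => _ /mapP[_ /mapP[[y z] _ ->] ->].
  rewrite lfunE /= (leftT_mul M_module).
  exact: (bracket_strictly_triangular D_mono (triT y) (triT z)).
have [U stabU nsMU|e be tri] := @triangular_basis F M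
    (fun f => exists x, f = leftT lact x \/ f = rightS ract x).
- have [x|x v|//|v vU TSv] := stable_extension M_module _ nilA (U := U).
  + by case: (splitTS x).
  + by apply: stabU; exists x; left.
  by exists v => // f [x [] ->]; case: (TSv x).
by exists e => // x; split; apply: tri; exists x; [left | right].
Qed.
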